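(* Let $m\ge 1$, let $c=(c_1,\dots,c_m)$ be a vector of positive integers, and let $M$ be a proper $c$-multicomplex such that the Murai sphere $\mathrm{Bier}_c(M)$ is flag. Then the $\gamma$-vector $\gamma(\mathrm{Bier}_c(M))$ is the $f$-vector of a flag simplicial complex. (That is, the Nevo–Petersen conjecture holds in the class of flag Murai spheres.)
   Context: A $c$-monomial is a monomial $x^a=x_1^{a_1}\cdots x_m^{a_m}$ with $0\le a_i\le c_i$ for all $i$. A $c$-multicomplex is a non-empty set $M$ of $c$-monomials closed under taking divisors; it is proper if it is not the set of all $c$-monomials. Let $\tilde X_i=\{x_i^{(0)},\dots,x_i^{(c_i)}\}$ and $\tilde X=\tilde X_1\sqcup\dots\sqcup\tilde X_m$ (formal symbols). For a $c$-monomial $x^a$ put $F_c(x^a)=\tilde X\setminus\{x_1^{(a_1)},\dots,x_m^{(a_m)}\}$. For a proper $c$-multicomplex $M$ the Murai sphere $\mathrm{Bier}_c(M)$ is the simplicial complex on $\tilde X$ whose set of maximal faces is $$\{F_c(x^a)\setminus\{x_i^{(j)}\} : x^a\in M,\ 1\le i\le m,\ a_i<j\le c_i,\ x^a x_i^{-a_i+j}\notin M\}.$$ It is a simplicial sphere of dimension $|c|-2$, where $|c|=c_1+\dots+c_m$. A simplicial complex is flag if all its minimal non-faces (inclusion-minimal subsets of the ground set that are not faces) have cardinality $\le 2$ (ghost vertices, i.e. minimal non-faces of cardinality 1, are allowed). For an $(n-1)$-dimensional simplicial complex $L$, the $f$-vector is $(f_{-1},f_0,\dots,f_{n-1})$,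 where $f_i$ is the number of $i$-dimensional faces ($f_{-1}=1$). The $h$-vector $(h_0,\dots,h_n)$ is defined by $h_0t^n+\dots+h_{n-1}t+h_n=(t-1)^n+f_0(t-1)^{n-1}+\dots+f_{n-1}$. If the $h$-vector is symmetric (as is the case for simplicial spheres), the $\gamma$-vector $\gamma(L)=(\gamma_0,\dots,\gamma_{\lfloor n/2\rfloor})$ is defined by $h_0+h_1t+\dots+h_nt^n=\sum_{i=0}^{\lfloor n/2\rfloor}\gamma_it^i(1+t)^{n-2i}$. ''The $\gamma$-vector is the $f$-vector of a complex $\Gamma$'' means $\gamma_i=f_{i-1}(\Gamma)$ for all $i$, where trailing zeros are ignored (both sequences are extended by zeros). *)

(* Defs.v *)
From mathcomp Require Import all_boot all_order all_algebra.

Set Implicit Arguments.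
Unset Strict Implicit.
Unset Printing Implicit Defensive.

Import GRing.Theory.

Section Complexes.

Variable T : finType.
Implicit Types (K : {set {set T}}) (s t : {set T}).

(* Elements of T need not be vertices of K (ghost vertices). *)
Definition simplicial_complex K : Prop :=
  set0 \in K /\ (forall s t, s \subset t -> t \in K -> s \in K).

Definition flag K : Prop :=
  forall s, minset (fun t => t \notin K) s -> #|s| <= 2.

(* The n such that K has dimension n - 1. *)
Definition rank_complex K : nat := \max_(s in K) #|s|.

(* Indexed by cardinality: fnum K i is f_{i-1}. *)
Definition fnum K (i : nat) : nat := #|[set s in K | #|s| == i]|.

Definition hnum K (k : nat) : int :=
  let n := rank_complex K in
  ((\sum_(i < n.+1) ('X - 1%:P) ^+ (n - i) *+ fnum K i : {poly int})`_(n - k))%R.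

(* g is the gamma-vector of K, extended by zeros. Such a g exists if and only
   if the h-vector of K is symmetric, and is then unique (gamma_vector_uniq). *)
Definition gamma_vector K (g : nat -> int) : Prop :=
  let n := rank_complex K in
  (\poly_(k < n.+1) hnum K k =
     \sum_(i < n./2.+1) g i *: ('X^i * (1 + 'X) ^+ (n - i.*2)))%R
  /\ (forall i, n./2 < i -> g i = 0%R).

Lemma gamma_vector_uniq K g1 g2 :
  gamma_vector K g1 -> gamma_vector K g2 -> g1 =1 g2.
Proof.
rewrite /gamma_vector; set n := rank_complex K => -[E1 z1] [E2 z2] i.
have [lein|ltni] := leqP i n./2; last by rewrite z1 ?z2.
move: E1; rewrite {}E2 => E; elim/ltn_ind: i lein => i IHi lein.
have := congr1 (fun p : {poly int} => p`_i)%R E; rewrite !coef_sum {E}.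
rewrite (bigD1 (Ordinal (lein : i < n./2.+1))) //=.
rewrite [in RHS](bigD1 (Ordinal (lein : i < n./2.+1))) //=.
rewrite !coefZ coefXnM ltnn subnn -horner_coef0.
rewrite horner_exp hornerD hornerX hornerC addr0 expr1n !mulr1.
set s1 := (X in (_ + X)%R = _); set s2 := (X in _ = (_ + X)%R).
suff -> : s1 = s2 by move/addIr.
apply: eq_bigr => j neji; rewrite !coefZ coefXnM.
have [//|leji] := ltnP i j; first by rewrite !mulr0.
have ltji : j < i.
  rewrite ltn_neqAle leji andbT; apply: contraNneq neji => eji.
  exact/eqP/val_inj.
by rewrite IHi // (leq_trans (ltnW ltji)).
Qed.

End Complexes.

Section Murai.

Variables (m : nat) (c : 'I_m -> nat).

(* The c-monomial x^a is represented by its exponent vector a. *)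
Definition cmonomial := {dffun forall i : 'I_m, 'I_(c i).+1}.

(* The pair (i, j) is the symbol x_i^{(j)}. *)
Definition cvertex := {i : 'I_m & 'I_(c i).+1}.

Definition sym (i : 'I_m) (j : 'I_(c i).+1) : cvertex :=
  Tagged (fun k => 'I_(c k).+1) j.

Definition cdvd (a b : cmonomial) : bool := [forall i, a i <= b i].

Definition multicomplex (M : {set cmonomial}) : Prop :=
  M != set0 /\ (forall a b, cdvd a b -> b \in M -> a \in M).

Definition proper_multicomplex (M : {set cmonomial}) : Prop :=
  multicomplex M /\ M != setT.

Definition Fc (a : cmonomial) : {set cvertex} := ~: [set sym (a i) | i : 'I_m].

(* The monomial x^a x_i^{j - a_i}. *)
Definition set_exponent (a : cmonomial) (i : 'I_m) (j : 'I_(c i).+1) :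
  cmonomial := [ffun k => dfwith a j k].

Definition Bier_facets (M : {set cmonomial}) : {set {set cvertex}} :=
  [set s | [exists a in M, exists i : 'I_m, exists j : 'I_(c i).+1,
     [&& a i < j, set_exponent a j \notin M & s == Fc a :\ sym j]]].

Definition Bier (M : {set cmonomial}) : {set {set cvertex}} :=
  [set s : {set cvertex} | [exists t in Bier_facets M, s \subset t]].

Lemma card_Fc a : #|Fc a| = #|{: cvertex}| - m.
Proof.
rewrite /Fc cardsCs setCK card_imset ?card_ord // => i j.
by move/(congr1 (@tag _ _)).
Qed.

Lemma card_Bier_facets M s :
  s \in Bier_facets M -> #|s| = #|{: cvertex}| - m.+1.
Proof.
rewrite inE => /existsP[a /andP[_ /existsP[i /existsP[j]]]].
move=> /and3P[aij _ /eqP->].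
rewrite subnS -(card_Fc a) (cardsD1 (sym j) (Fc a)).
suff -> : sym j \in Fc a by [].
rewrite in_setC; apply/imsetP => -[k _ E].
have Eik : i = k by move/(congr1 (@tag _ _)): E.
subst k; move: aij.
by rewrite (eq_from_Tagged E) ltnn.
Qed.

Lemma Bier_facets_maximal M s :
  (s \in Bier_facets M) = maxset (mem (Bier M)) s.
Proof.
apply/idP/maxsetP => [sF|[]].
  split=> [|t]; first by rewrite /= inE; apply/existsP; exists s; rewrite sF /=.
  rewrite /= inE => /existsP[u /andP[uF tu]] st; apply/eqP; rewrite eq_sym.
  rewrite eqEcard st (card_Bier_facets sF) -(card_Bier_facets uF).
  exact: subset_leq_card.
rewrite /= inE => /existsP[t /andP[tF st]] max.
suff <- : t = s by [].
by apply: max => //; rewrite /= inE; apply/existsP; exists t; rewrite tF /=.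
Qed.

End Murai.

(* Main.v *)
Require Import Defs.
From mathcomp Require Import all_boot all_order all_algebra zify ring.

Set Implicit Arguments.
Unset Strict Implicit.
Unset Printing Implicit Defensive.

Import GRing.Theory.

(** A set s of symbols is a face of Bier_c(M) iff its complement U meets every
    X_i, the vector of minima of U is in M and the vector of maxima is not.
    Writing the face indicator as [min U in M] - [max U in M] and summing
    (t - 1)^(|U| - m) over U gives
      (t - 1) sum_k h_k t^(n-k) = sum_(a in M) (t^(|c| - |a|) - t^|a|).

    If the sphere is flag, then every c-monomial outside M is a multiple of one
    of degree at most 2 outside M, and dually every a in M divides some b in M
    with |c| - |b| <= 2; moreover c_i = 1 for every variable x_i which does not
    affect membership in M. Such a variable only contributes a factor 1 + t to
    the h-polynomial, so it does not change gamma. The remaining variables have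
    total degree N <= 4: each of their exponents is covered by the codegrees of
    two suitable elements of M, each at most 2. Hence gamma = (1, g, 0, ...),
    where, q_k being the number of elements of M of degree k in the remaining
    variables, g = q_1 - q_2 - 1 for N = 3, g = q_1 - q_3 - 2 for N = 4 and
    g = 0 otherwise. As g >= 0, it is the f-vector of g isolated points. *)

(* Atoms such as [P f] or [i != k] make the preprocessing of [lia] very slow. *)
Ltac nat_lia := repeat match goal with
  H : is_true ?b |- _ => lazymatch b with _ <= _ => fail | _ => clear H end end;
  lia.

(** * Lower sets of exponent vectors generated in degree two *)

Section Exponents.

Variables (I : finType) (c : I -> nat) (P : (I -> nat) -> bool) (K : {set I}).

Definition pw_le (f g : I -> nat) := forall i, f i <= g i.

Hypothesis c_gt0 : forall i, 0 < c i.
Hypothesis P_le : forall f g, pw_le f g -> P g -> P f.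
Hypothesis P0 : P (fun=> 0).
(* The monomials outside P are generated in degree at most 2, and dually. *)
Hypothesis gen : forall b, ~~ P b -> pw_le b c ->
  exists g, [/\ pw_le g b, ~~ P g & \sum_i g i <= 2].
Hypothesis cogen : forall a, P a -> pw_le a c ->
  exists a', [/\ pw_le a a', pw_le a' c, P a' & \sum_i (c i - a' i) <= 2].

Definition upd (f : I -> nat) (i : I) n (k : I) := if k == i then n else f k.

(* K consists of the variables on which membership in P really depends. *)
Hypothesis coreP : forall i,
  reflect (exists f, [/\ pw_le f c, P f & ~~ P (upd f i (c i))]) (i \in K).

Definition e1 (i k : I) : nat := k == i.
Definition e2 (i j k : I) : nat := (k == i) + (k == j).

Lemma le_sum1 (g : I -> nat) i : g i <= \sum_k g k.
Proof. by rewrite (bigD1 i) //= leq_addr. Qed.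

Lemma le_sum2 (g : I -> nat) i k : k != i -> g i + g k <= \sum_l g l.
Proof. by move=> ki; rewrite (bigD1 i) //= (bigD1 k) //= addnA leq_addr. Qed.

Lemma le_sum3 (g : I -> nat) i k l :
  k != i -> l != i -> l != k -> g i + g k + g l <= \sum_r g r.
Proof.
move=> ki li lk; rewrite (bigD1 i) //= (bigD1 k) //= (bigD1 l) ?li //=.
by rewrite !addnA leq_addr.
Qed.

Lemma P_ext f g : f =1 g -> P f -> P g.
Proof. by move=> fg; apply: P_le => i; rewrite fg. Qed.

Lemma nP_le f g : pw_le f g -> ~~ P f -> ~~ P g.
Proof. by move=> fg; apply: contraNN; apply: P_le. Qed.

Lemma e1_le f i : 0 < f i -> pw_le (e1 i) f.
Proof. by move=> fi k; rewrite /e1; case: eqP => [->|]. Qed.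

Lemma e2_le f i k : i != k -> 0 < f i -> 0 < f k -> pw_le (e2 i k) f.
Proof.
move=> ik fi fk l; rewrite /e2.
have [->|li] := eqVneq l i; first by rewrite (negPf ik).
by have [->|] := eqVneq l k.
Qed.

Lemma e2d_le f i : 1 < f i -> pw_le (e2 i i) f.
Proof. by move=> fi k; rewrite /e2; case: eqP => [->|]. Qed.

Lemma e1_bound f i : P f -> ~~ P (e1 i) -> f i = 0.
Proof.
move=> Pf Pi; have [//|fi] := posnP (f i).
by case/negP: Pi; apply: P_le Pf; apply: e1_le.
Qed.

Lemma e2_bound f i k : i != k -> P f -> ~~ P (e2 i k) -> f i = 0 \/ f k = 0.
Proof.
move=> ik Pf Pi; have [|fi] := posnP (f i); first by left.
have [|fk] := posnP (f k); first by right.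
by case/negP: Pi; apply: P_le Pf; apply: e2_le.
Qed.

Lemma e2d_bound f i : P f -> ~~ P (e2 i i) -> f i <= 1.
Proof.
move=> Pf Pi; rewrite leqNgt; apply/negP => fi.
by case/negP: Pi; apply: P_le Pf; apply: e2d_le.
Qed.

(** Raising exponent [i] of the witness [f] to [c i] leaves [P], so some nonmember [g] of degree at
    most 2 lies below the raised vector. It has [f i < g i], else it would lie below [f]; hence it
    lies below [e1 i], some [e2 i k], or [e2 i i]. *)
Lemma core_gen i : i \in K ->
  [\/ ~~ P (e1 i), exists k, [/\ i != k, P (e1 k) & ~~ P (e2 i k)]
    | 1 < c i /\ ~~ P (e2 i i)].
Proof.
case/coreP => f [fc Pf Pu].
have uc : pw_le (upd f i (c i)) c.
  by move=> k; rewrite /upd; case: eqP => [->|].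
have [g [gu Pg g2]] := gen Pu uc.
have gk k : k != i -> g k <= f k.
  by move=> /negPf ki; have := gu k; rewrite /upd ki.
have gi : f i < g i.
  rewrite ltnNge; apply/negP => gf; case/negP: Pg; apply: P_le Pf => k.
  by have [->|/gk] := eqVneq k i.
have gic : g i <= c i by have := gu i; rewrite /upd eqxx.
have [g1|g1] := ltnP 1 (g i).
  constructor 3; split; first exact: leq_trans g1 gic.
  apply: nP_le Pg => k; rewrite /e2; have [->|ki] := eqVneq k i.
    by have := le_sum1 g i; nat_lia.
  by have := le_sum2 g ki; nat_lia.
have [/existsP[k /andP[ki gk0]]|/existsPn none] :=
  boolP [exists k, (k != i) && (0 < g k)].
  constructor 2; exists k; rewrite eq_sym ki; split => //.
    by apply: P_le Pf; apply: e1_le; apply: leq_trans gk0 (gk _ ki).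
  apply: nP_le Pg => l; rewrite /e2; have := le_sum1 g l.
  have [->|li] := eqVneq l i; first by nat_lia.
  have [->|lk] := eqVneq l k; first by have := le_sum2 g ki; nat_lia.
  by have := le_sum3 g ki li lk; nat_lia.
constructor 1; apply: nP_le Pg => k; rewrite /e1.
by have := none k; have [->|] /= := eqVneq k i; nat_lia.
Qed.

Lemma core_edge i k : i != k -> P (e1 k) -> ~~ P (e2 i k) -> i \in K.
Proof.
move=> ik Pk Pik; apply/coreP; exists (e1 k); split => //.
  by move=> l; rewrite /e1; case: eqP => // ->.
apply: nP_le Pik => l; rewrite /e1 /e2 /upd.
by have [->|] := eqVneq l i; rewrite ?(negPf ik) ?addn0.
Qed.

(** * The total degree of the core is at most four *)

Definition core_deg := \sum_(i in K) c i.

(** Typically [w] is the sum of two codegree vectors obtained from [cogen], each of total at most 2;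
    at [i] it suffices that one of the two members vanishes. *)
Lemma core_deg_le (w : I -> nat) n :
  (forall i, i \in K -> c i <= w i) -> \sum_i w i <= n -> core_deg <= n.
Proof.
move=> cw; apply: leq_trans; rewrite [leqRHS](bigID [in K]) /=.
by apply: leq_trans (leq_addr _ _); apply: leq_sum.
Qed.

(** Here [s] is the largest exponent of [p] in [P] and falls short of [c p]. A member [a] above
    x_p^s with codegree at most 2 spends at least one unit on [p], so at most one other variable [k]
    is not full in [a]. *)
Lemma core_deg_bounded p s :
  s <= 1 -> s < c p -> (forall f, P f -> f p <= s) ->
  P (fun k => s * (k == p)) -> core_deg <= 4.
Proof.
move=> s1 sc Pp Ps.
have [|a [sa ac Pa da]] := cogen Ps.
  by move=> k; have [->|] := eqVneq k p; rewrite ?muln1 ?muln0 // ltnW.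
have ap : a p = s.
  by apply/eqP; rewrite eqn_leq Pp //=; have := sa p; rewrite eqxx muln1.
have Pe1p : P (e1 p) -> 0 < a p by move/Pp; rewrite /e1 eqxx ap.
have dp := le_sum1 (fun i => c i - a i) p; rewrite /= in dp.
have aP k l : k != l -> ~~ P (e2 k l) -> a k = 0 \/ a l = 0 by move/e2_bound; apply.
(* The weight is the codegree vector of [a] plus one at each of [p] and [k], in total at most 2 + 1
   + 1. *)
have small k : (forall i, i \in K -> i = p \/ i = k /\ c k <= (c k - a k).+1) ->
    core_deg <= 4.
  move=> Kpk; apply: (@core_deg_le (fun i => (c i - a i) + (i == p) + (i == k))).
    move=> i /Kpk[->|[->]]; first by rewrite eqxx; nat_lia.
    by rewrite (eqxx k); nat_lia.
  rewrite !big_split /= -!big_mkcondr /= !sum1_card.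
  by rewrite -/(#|pred1 p|) -/(#|pred1 k|) !card1; nat_lia.
have [/existsP[k /andP[kp ak]]|/existsPn none] :=
    boolP [exists k, (k != p) && (a k < c k)]; last first.
  (* With every variable but [p] full, the nonmember that [core_gen] attaches to another core
     variable would lie below [a]. *)
  apply: (small p) => i iK; left; apply/eqP/negPn/negP => ip.
  have := none i; rewrite ip /= -leqNgt => ai; have ci := c_gt0 i.
  have full l : P (e1 l) -> 0 < a l.
    have [->//|lp _] := eqVneq l p.
    by have := none l; have := c_gt0 l; rewrite lp; nat_lia.
  case: (core_gen iK) => [/(e1_bound Pa)|[k [ik Pk /(aP _ _ ik)]]|].
  - by nat_lia.
  - by have := full k Pk; nat_lia.
  - by case=> ci2 /(e2d_bound Pa); nat_lia.
have dpk := le_sum2 (fun i => c i - a i) kp; rewrite /= in dpk.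
have full i : i != p -> i != k -> a i = c i.
  move=> ip ik; have := le_sum3 (fun i => c i - a i) kp ip ik.
  by have := ac i; rewrite /=; nat_lia.
(* Such a variable is full in [a], so its nonmember can only be x_i x_k, with x_k absent from
   [a]. *)
have edge i : i \in K -> i != p -> i != k ->
    [/\ P (e1 k), ~~ P (e2 i k) & a k = 0].
  move=> iK ip ik; have ai := full i ip ik; have ci := c_gt0 i.
  case: (core_gen iK) => [/(e1_bound Pa)|[l [il Pl Pil]]|[c2 /(e2d_bound Pa)]].
  - by nat_lia.
  - have [ai0|al] := aP _ _ il Pil; first by nat_lia.
    have [lk|lk] := eqVneq l k; first by subst l.
    have [lp|lp] := eqVneq l p; first by subst l; have := Pe1p Pl; nat_lia.
    by have := c_gt0 l; rewrite -(full l lp lk) al.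
  - by nat_lia.
have [/existsP[i /and3P[iK ip ik]]|/existsPn none] :=
    boolP [exists i, [&& i \in K, i != p & i != k]].
  have [Pk _ ak0] := edge i iK ip ik.
  (* Since [a'] contains x_k, it vanishes at every core variable other than [p] and [k], while [a]
     vanishes at [k]. At [p] both exponents are at most [s], and [s <= 1], [s < c p] give
     [c p <= 2 * (c p - s)]. *)
  have [|a' [ka ac' Pa' da']] := cogen Pk; first exact: e1_le.
  have ak' : 0 < a' k by have := ka k; rewrite /e1 eqxx.
  apply: (@core_deg_le (fun i => (c i - a i) + (c i - a' i))); last first.
    by rewrite big_split /=; nat_lia.
  move=> l lK; have [->|lp] := eqVneq l p; first by have := Pp _ Pa'; nat_lia.
  have [->|lk] := eqVneq l k; first by nat_lia.
  by have [_ /(e2_bound lk Pa')] := edge l lK lp lk; nat_lia.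
apply: (small k) => i iK; have := none i; rewrite iK /=.
have [->|ip] := eqVneq i p; first by left.
rewrite /= negbK => /eqP ik; right; split=> //; subst i.
case: (core_gen iK) => [/(e1_bound Pa)|[l [kl Pl /(aP _ _ kl)]]|[_ /(e2d_bound Pa)]].
- by nat_lia.
- case=> [|al]; first by nat_lia.
  have [lp|lp] := eqVneq l p; first by subst l; have := Pe1p Pl; nat_lia.
  by have := full l lp; rewrite eq_sym kl => /(_ isT); have := c_gt0 l; nat_lia.
- by nat_lia.
Qed.

(* The variables absent from a maximal [a] have total degree at most 2. If their
   product [z] satisfies P, an element above [z] misses all their neighbours. *)
Lemma core_deg_graph :
  (forall i, P (e1 i)) -> (forall i, 1 < c i -> P (e2 i i)) -> core_deg <= 4.
Proof.
move=> Pe1 Pe2.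
have edge i : i \in K -> exists2 k, i != k & ~~ P (e2 i k).
  case/core_gen => [|[k [ik _ Pik]]|[ci]]; first by rewrite Pe1.
    by exists k.
  by rewrite Pe2.
have [//|a [_ ac Pa da]] := cogen P0.
pose z i : nat := a i == 0.
have zc : pw_le z c by move=> i; rewrite /z; case: (a i == 0).
have [Pz|Pz] := boolP (P z).
  have [a' [za ac' Pa' da']] := cogen Pz zc.
  apply: (@core_deg_le (fun i => (c i - a i) + (c i - a' i))); last first.
    by rewrite big_split /=; nat_lia.
  move=> i /edge[k ik Pik]; have := e2_bound ik Pa Pik.
  by have := e2_bound ik Pa' Pik; have := za k; rewrite /z; nat_lia.
(* All single variables are in [P], so a nonmember of degree at most 2 below the 0/1 vector [z] is
   some x_i x_k with [i != k]. Both are absent from [a] and use up its codegree 2. *)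
have [g [gz Pg g2]] := gen Pz zc.
have [i gi] : exists i, 0 < g i.
  apply/existsP; apply: contraNT Pg => /existsPn g0; apply: P_le P0 => i.
  by rewrite leqNgt.
have g01 k : g k <= 1 by have := gz k; rewrite /z; nat_lia.
have [k /andP[ki gk]] : exists k, (k != i) && (0 < g k).
  apply/existsP; apply: contraNT Pg => /existsPn g0.
  apply: P_le (Pe1 i) => k; have := g0 k; rewrite /e1.
  by have [->|] /= := eqVneq k i; rewrite ?g01 // lt0n negbK => _ /eqP->.
have ai : a i = 0 by have := gz i; rewrite /z; nat_lia.
have ak : a k = 0 by have := gz k; rewrite /z; nat_lia.
have Pik : ~~ P (e2 k i).
  apply: nP_le Pg => l; rewrite /e2; have := le_sum1 g l.
  have [->|lk] := eqVneq l k; first by have := g01 k; nat_lia.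
  have [->|li] := eqVneq l i; first by have := g01 i; nat_lia.
  by have := le_sum3 g ki li lk; nat_lia.
have [|x [ix xc Px dx]] := cogen (Pe1 i); first exact: e1_le.
have [|y [ky yc Py dy]] := cogen (Pe1 k); first exact: e1_le.
have xi : 0 < x i by have := ix i; rewrite /e1 eqxx.
have yk : 0 < y k by have := ky k; rewrite /e1 eqxx.
(* [y] vanishes at [i] and [x] at [k]. Any other core variable occurs in [a], so its neighbour [r]
   is absent from [a]; as there is no room for a third absent variable, [r] is [i] or [k], and [x]
   or [y] vanishes at that core variable. *)
apply: (@core_deg_le (fun i => (c i - x i) + (c i - y i))); last first.
  by rewrite big_split /=; nat_lia.
move=> l lK; have [->|li] := eqVneq l i.
  by have := e2_bound ki Py Pik; nat_lia.
have [->|lk] := eqVneq l k; first by have := e2_bound ki Px Pik; nat_lia.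
have al : 0 < a l.
  have := le_sum3 (fun i => c i - a i) ki li lk.
  by have := c_gt0 i; have := c_gt0 k; have := c_gt0 l; rewrite /=; nat_lia.
have [r lr Plr] := edge l lK.
have ar : a r = 0 by have := e2_bound lr Pa Plr; nat_lia.
have [ri|ri] := eqVneq r i.
  by subst r; have := e2_bound lr Px Plr; nat_lia.
have [rk|rk] := eqVneq r k.
  by subst r; have := e2_bound lr Py Plr; nat_lia.
have := le_sum3 (fun i => c i - a i) ki ri rk.
by have := c_gt0 i; have := c_gt0 k; have := c_gt0 r; rewrite /=; nat_lia.
Qed.

(** Three cases: some variable is outside [P] ([s = 0]), some square allowed by [c] is outside [P]
    ([s = 1]), or the quadratic nonmembers form a graph. *)
Lemma core_deg_le4 : core_deg <= 4.
Proof.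
have [/forallP Pe1|/forallPn[p Pp]] := boolP [forall i, P (e1 i)]; last first.
  apply: (@core_deg_bounded p 0) => //; first by move=> f /e1_bound ->.
have [/forallP Pe2|/forallPn[p]] := boolP [forall i, (1 < c i) ==> P (e2 i i)].
  by apply: core_deg_graph => // i; apply/implyP.
rewrite negb_imply => /andP[cp Pp].
apply: (@core_deg_bounded p 1) => //; first by move=> f /e2d_bound; apply.
by apply: P_ext (Pe1 p) => k; rewrite mul1n.
Qed.

(** * Members of codegree one and of degree one *)

Definition corank1 (i k : I) := if k == i then (c k).-1 else c k.

(** In x^c / x_i every variable but x_i is full, so the small nonmember of any other core variable
    x_k can only be x_i x_k, with [c i = 1]. A member above x_i then omits all other core variables,
    so their total degree is at most 2. *)
Lemma core_corank1 i : i \in K -> P (corank1 i) -> 2 < core_deg ->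
  core_deg <= 3 /\ exists2 k, k \in K & [/\ k != i, P (e1 i) & P (e1 k)].
Proof.
move=> iK Pi N3.
have full l : l != i -> 0 < corank1 i l by move=> li; rewrite /corank1 (negPf li).
have edge k : k \in K -> k != i -> [/\ P (e1 i), ~~ P (e2 k i) & c i <= 1].
  move=> kK ki; have fk := full k ki.
  case: (core_gen kK) => [/(e1_bound Pi)|[l [kl Pl Pkl]]|[ck /(e2d_bound Pi)]].
  - by nat_lia.
  - have [li|li] := eqVneq l i.
      subst l; split=> //; have := e2_bound kl Pi Pkl.
      by rewrite /corank1 eqxx (negPf ki); have := c_gt0 k; nat_lia.
    by have := e2_bound kl Pi Pkl; have := full l li; nat_lia.
  - by rewrite /corank1 (negPf ki); nat_lia.
have [/existsP[k /andP[kK ki]]|/existsPn none] :=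
    boolP [exists k, (k \in K) && (k != i)].
  have [Pe1i _ ci] := edge k kK ki; split; last first.
    exists k => //; split=> //; apply: P_le Pi; apply: e1_le; exact: full.
  have [|a [ia ac Pa da]] := cogen Pe1i; first exact: e1_le.
  have ai : 0 < a i by have := ia i; rewrite /e1 eqxx.
  apply: (@core_deg_le (fun l => (c l - a l) + (l == i))).
    move=> l lK; have [->|li] := eqVneq l i; first by nat_lia.
    by have [_ /(e2_bound li Pa)] := edge l lK li; nat_lia.
  rewrite big_split /= -big_mkcondr /= sum1_card -/(#|pred1 i|) card1; nat_lia.
(* If [i] is the only core variable, its own small nonmember forces [c i <= 2], against [N3]. *)
have : core_deg <= c i.
  apply: (@core_deg_le (fun l => (l == i) * c i)).
    move=> l lK; have := none l; rewrite lK /= negbK => /eqP->.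
    by rewrite eqxx mul1n.
  rewrite (bigD1 i) //= eqxx big1 ?addn0 ?mul1n // => l /negPf->.
  by rewrite mul0n.
case: (core_gen iK) => [/(e1_bound Pi)|[l [il Pl Pil]]|[_ /(e2d_bound Pi)]].
- by rewrite /corank1 eqxx; nat_lia.
- have := e2_bound il Pi Pil; have := full l; rewrite eq_sym il => /(_ isT).
  by rewrite {2}/corank1 eqxx; nat_lia.
- by rewrite /corank1 eqxx; nat_lia.
Qed.

(** The small nonmember of a core variable divides neither x^c / x_i nor x^c / x_k, so it can only
    be x_i x_k, with [c i = c k = 1]. *)
Lemma core_corank1_uniq i k : P (corank1 i) -> P (corank1 k) -> i != k ->
  i \in K -> core_deg <= 2.
Proof.
move=> Pi Pk ik iK; rewrite leqNgt; apply/negP => N3.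
have fi l : l != i -> 0 < corank1 i l by move=> li; rewrite /corank1 (negPf li).
have fk l : l != k -> 0 < corank1 k l by move=> li; rewrite /corank1 (negPf li).
have bad f l r : l != r -> P f -> 0 < f l -> 0 < f r -> ~~ P (e2 l r) -> False.
  by move=> lr Pf fl fr /(e2_bound lr Pf); nat_lia.
have lK l : l \in K -> c l <= (l == i) + (l == k).
  case/core_gen => [Pl|[r [lr Pr Plr]]|[cl Pl]].
  - have := e1_bound Pi Pl; have := e1_bound Pk Pl; rewrite /corank1.
    by have := c_gt0 l; have [->|] := eqVneq l i; rewrite ?(negPf ik); nat_lia.
  - have := e2_bound lr Pi Plr; have := e2_bound lr Pk Plr.
    rewrite /corank1; have := c_gt0 l; have := c_gt0 r.
    have rl : (r == l) = false by rewrite eq_sym (negPf lr).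
    have [li|li] := eqVneq l i; first by subst l; rewrite rl (negPf ik); nat_lia.
    have [lk|lk] := eqVneq l k; first by subst l; rewrite rl; nat_lia.
    have [ri|ri] := eqVneq r i; first by subst r; rewrite (negPf ik); nat_lia.
    by nat_lia.
  - have := e2d_bound Pi Pl; have := e2d_bound Pk Pl; rewrite /corank1.
    by have [->|] := eqVneq l i; rewrite ?(negPf ik); nat_lia.
suff: core_deg <= 2 by nat_lia.
apply: core_deg_le lK _.
by rewrite big_split /= -!big_mkcondr /= !sum1_card -/(#|pred1 i|)
   -/(#|pred1 k|) !card1.
Qed.

Lemma sum_core (a : I -> nat) : pw_le a c -> \sum_i (c i - a i) <= 2 ->
  core_deg <= (\sum_(i in K) a i) + 2.
Proof.
move=> ac da; have : \sum_(i in K) (c i - a i) <= 2.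
  by apply: leq_trans da; rewrite [leqRHS](bigID [in K]) /= leq_addr.
move=> dK.
apply: leq_trans (_ : _ <= \sum_(i in K) a i + \sum_(i in K) (c i - a i)) _.
  by rewrite -big_split /=; apply: leq_sum => i _; nat_lia.
by nat_lia.
Qed.

Lemma core_e1 : 2 < core_deg -> exists2 i, i \in K & P (e1 i).
Proof.
move=> N3; have [//|a [_ ac Pa da]] := cogen P0.
have := sum_core ac da => N.
have [/exists_inP//|/exists_inPn none] := boolP [exists i in K, P (e1 i)].
rewrite big1 in N; first by nat_lia.
by move=> i /none; apply: e1_bound.
Qed.

(** Some member [a] has degree at least 2 in the core. If x_i were the only core variable in [P],
    then [a i >= 2], so the small nonmember of [i] would be some x_i x_k, and [core_edge] would make
    x_k a second one. *)
Lemma core_e1_two : 3 < core_deg ->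
  exists i k, [/\ i \in K, k \in K, k != i, P (e1 i) & P (e1 k)].
Proof.
move=> N4; have [//|a [_ ac Pa da]] := cogen P0.
have N := sum_core ac da.
have [i iK Pi] := core_e1 (ltnW N4).
have [/existsP[k /and3P[kK ki Pk]]|/existsPn none] :=
    boolP [exists k, [&& k \in K, k != i & P (e1 k)]]; first by exists i, k.
have a0 k : k \in K -> k != i -> a k = 0.
  by move=> kK ki; have := none k; rewrite kK ki /=; apply: e1_bound.
rewrite (bigD1 i) //= big1 in N; last by move=> k /andP[]; apply: a0.
case: (core_gen iK) => [|[k [ik Pk Pik]]|[_ /(e2d_bound Pa)]].
- by rewrite Pi.
- have := none k; rewrite eq_sym ik Pk !andbT (@core_edge k i) // 1?eq_sym //.
  by apply: nP_le Pik => l; rewrite /e2 addnC.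
- by nat_lia.
Qed.

(** Exponents outside [K] can be raised to [c i] one at a time without leaving [P]; this turns [f]
    into a member above [g]. *)
Lemma P_core f g : pw_le f c -> pw_le g c -> {in K, f =1 g} -> P f -> P g.
Proof.
move=> fc gc fg Pf.
have [h [hc hf hK Ph]] : exists h, [/\ pw_le h c, pw_le f h,
    forall i, i \notin K -> h i = c i & P h].
  suff H (s : seq I) : exists h, [/\ pw_le h c, pw_le f h,
    forall i, i \in s -> i \notin K -> h i = c i & P h].
    have [h [hc fh hK Ph]] := H (enum I); exists h; split=> // i.
    by apply: hK; rewrite mem_enum.
  elim: s => [|i s [h [hc fh hK Ph]]]; first by exists f; split=> // i.
  have [iK|iK] := boolP (i \in K).
    by exists h; split=> // k; rewrite inE => /orP[/eqP->|/hK//]; rewrite iK.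
  exists (upd h i (c i)); split.
  - by move=> k; rewrite /upd; case: eqP => // ->.
  - by move=> k; rewrite /upd; case: eqP => // ->.
  - by move=> k; rewrite inE /upd; case: eqP => //= [->|_ /hK].
  - by apply/negPn/negP => Pu; case/negP: iK; apply/coreP; exists h.
apply: P_le Ph => i; have [iK|/hK->//] := boolP (i \in K).
by rewrite -fg // fh.
Qed.

End Exponents.

(** * The h-polynomial of a Murai sphere *)

Lemma sum_interval_expr (R : comNzRingType) (T : finType) (A B : {set T}) (x : R) :
  [disjoint A & B] ->
  (\sum_(J : {set T} | (A \subset J) && (J \subset A :|: B)) x ^+ (#|J| - #|A|)
     = (1 + x) ^+ #|B|)%R.
Proof.
move=> dAB.
(* [F i] and [G i] are the weights of [i] being in [J] or not; a zero weight excludes each [J]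
   outside the interval. *)
pose F i : R := (if i \in A then 1 else if i \in B then x else 0)%R.
pose G i : R := (if i \in A then 0 else 1)%R.
have <- : (\prod_i (F i + G i) = (1 + x) ^+ #|B|)%R.
  rewrite -prodr_const [RHS]big_mkcond /=; apply: eq_bigr => i _.
  rewrite /F /G; have [iA|iA] := boolP (i \in A).
    by rewrite addr0 (disjointFr dAB).
  by case: (i \in B); rewrite ?add0r // addrC.
rewrite bigA_distr [LHS]big_mkcond /=; apply: eq_bigr => J _.
case: ifPn => [/andP[AJ JAB]|].
  rewrite -cardsDS // -prodr_const [LHS]big_mkcond /=; apply: eq_bigr => i _.
  rewrite inE /F /G; have [iJ|iJ] := boolP (i \in J); last first.
    by rewrite andbF; have [iA|//] := boolP (i \in A); rewrite (subsetP AJ) in iJ.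
  rewrite andbT; case: (boolP (i \in A)) => //= iA.
  by have := subsetP JAB _ iJ; rewrite inE (negPf iA) /= => ->.
rewrite negb_and => /orP[] /subsetPn[i iA iJ].
  by rewrite (bigD1 i) //= (negPf iJ) /G iA mul0r.
move: iJ; rewrite inE negb_or => /andP[/negPf iA' /negPf iB].
by rewrite (bigD1 i) //= iA /F iA' iB mul0r.
Qed.

Lemma card_le_rank (T : finType) (K : {set {set T}}) s :
  s \in K -> #|s| <= rank_complex K.
Proof. by move=> sK; rewrite /rank_complex (bigD1 s) //= leq_maxl. Qed.

Lemma sum_by_value (R : nzRingType) (T : finType) (A : {set T}) (d : T -> nat)
    n (F : nat -> R) :
  (forall s, s \in A -> d s <= n) ->
  (\sum_(i < n.+1) F i *+ #|[set s in A | d s == i]| = \sum_(s in A) F (d s))%R.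
Proof.
move=> An.
rewrite [RHS](partition_big (fun s : T => inord (d s) : 'I_n.+1) xpredT) //=.
apply: eq_bigr => i _; rewrite -sumr_const.
apply: eq_big => [s|s]; last by rewrite inE => /andP[_ /eqP->].
rewrite inE; case: (boolP (s \in A)) => //= /An sn.
by rewrite -val_eqE /= inordK.
Qed.

Lemma card_ord_gt n k : #|(fun j : 'I_n => k < j)| = n - k.+1.
Proof.
rewrite -sum1_card -(big_mkord (fun j => k < j) (fun=> 1)).
by rewrite -(big_nat_widenl k.+1 0 n predT (fun=> 1)) // sum_nat_const_nat muln1.
Qed.

Lemma card_ord_lt n k : k <= n -> #|(fun j : 'I_n => j < k)| = k.
Proof.
move=> kn; rewrite -sum1_card -(big_mkord (fun j => j < k) (fun=> 1)).
by rewrite -(big_nat_widen 0 k n predT (fun=> 1)) // sum_nat_const_nat subn0 muln1.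
Qed.

Section Murai.

Variables (m : nat) (c : 'I_m -> nat).
Implicit Types (a b : cmonomial c) (U s : {set cvertex c}) (M : {set cmonomial c}).

Definition deg a := \sum_i (a i : nat).
Definition deg_max := \sum_i c i.

Lemma leq_deg_max a : deg a <= deg_max.
Proof. by apply: leq_sum => i _; rewrite -ltnS. Qed.

Lemma deg_maxB a : deg_max - deg a = \sum_i (c i - a i).
Proof.
apply/eqP; rewrite -(eqn_add2r (deg a)) subnK ?leq_deg_max // -big_split /=.
by apply/eqP/eq_bigr => i _; rewrite subnK // -ltnS.
Qed.

Lemma card_cvertex_set (Q : forall i, pred 'I_(c i).+1) :
  #|[set u : cvertex c | Q (tag u) (tagged u)]| = \sum_i #|Q i|.
Proof.
rewrite -sum1_card; under [RHS]eq_bigr do rewrite -sum1_card.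
by rewrite sig_big_dep /=; apply: eq_bigl => u; rewrite inE.
Qed.

Lemma card_cvertex : #|{: cvertex c}| = deg_max + m.
Proof.
rewrite -cardsT (_ : setT = [set u : cvertex c | true]); last first.
  by apply/setP => u; rewrite !inE.
rewrite (@card_cvertex_set (fun=> predT)).
under eq_bigr do rewrite card_ord -addn1.
by rewrite big_split /= sum_nat_const card_ord muln1.
Qed.

(** A relation rather than a function: minima exist only if [U] meets every X_i. *)
Definition is_min U a :=
  [forall i, sym (a i) \in U] && [forall u in U, a (tag u) <= tagged u].
Definition is_max U a :=
  [forall i, sym (a i) \in U] && [forall u in U, tagged u <= a (tag u)].

Lemma is_minP U a : reflect
  ((forall i, sym (a i) \in U) /\
   forall i (j : 'I_(c i).+1), sym j \in U -> a i <= j) (is_min U a).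
Proof.
apply: (iffP andP) => [[/forallP aU /forall_inP Ua]|[aU Ua]].
  by split=> // i j /Ua.
by split; [apply/forallP|apply/forall_inP => -[i j] /Ua].
Qed.

Lemma is_maxP U a : reflect
  ((forall i, sym (a i) \in U) /\
   forall i (j : 'I_(c i).+1), sym j \in U -> j <= a i) (is_max U a).
Proof.
apply: (iffP andP) => [[/forallP aU /forall_inP Ua]|[aU Ua]].
  by split=> // i j /Ua.
by split; [apply/forallP|apply/forall_inP => -[i j] /Ua].
Qed.

Lemma exists_min U a : (forall i, sym (a i) \in U) -> exists b, is_min U b.
Proof.
move=> aU; pose b : cmonomial c :=
  [ffun i => [arg min_(j < a i | sym j \in U) (j : nat)]].
exists b; apply/is_minP; split => [i|i j jU]; rewrite ffunE.
  by case: arg_minnP => //; apply: aU.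
by case: arg_minnP => [|k _]; [apply: aU|apply].
Qed.

Lemma exists_max U a : (forall i, sym (a i) \in U) -> exists b, is_max U b.
Proof.
move=> aU; pose b : cmonomial c :=
  [ffun i => [arg max_(j > a i | sym j \in U) (j : nat)]].
exists b; apply/is_maxP; split => [i|i j jU]; rewrite ffunE.
  by case: arg_maxnP => //; apply: aU.
by case: arg_maxnP => [|k _]; [apply: aU|apply].
Qed.

Lemma is_min_uniq U a b : is_min U a -> is_min U b -> a = b.
Proof.
move=> /is_minP[aU Ua] /is_minP[bU Ub]; apply/ffunP => i; apply/val_inj/eqP.
by rewrite /= eqn_leq Ua // Ub.
Qed.

Lemma is_max_uniq U a b : is_max U a -> is_max U b -> a = b.
Proof.
move=> /is_maxP[aU Ua] /is_maxP[bU Ub]; apply/ffunP => i; apply/val_inj/eqP.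
by rewrite /= eqn_leq Ub // Ua.
Qed.

Section Multicomplex.

Variables (M : {set cmonomial c}).
Hypothesis M_dvd : forall a b, cdvd a b -> b \in M -> a \in M.

(* Replacing the entries of [a] by those of [b] one at a time leaves [M] at
   some step: the monomials before and after it give a facet containing [s]. *)
Lemma in_Bier s :
  reflect (exists a b, [/\ is_min (~: s) a, is_max (~: s) b, a \in M & b \notin M])
    (s \in Bier M).
Proof.
apply: (iffP idP) => [|[a [b [/is_minP[aU Ua] /is_maxP[bU Ub] aM bM]]]].
  rewrite inE => /existsP[t /andP[+ st]]; rewrite inE.
  case/existsP=> a /andP[aM /existsP[i /existsP[j /and3P[aij ajM /eqP tE]]]].
  have aU k : sym (a k) \in ~: s.
    rewrite inE; apply: contraL st => aks; apply/subsetPn; exists (sym (a k)) => //.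
    by rewrite tE in_setD1 negb_and in_setC negbK;
      rewrite (imset_f (fun i => sym (a i))) ?orbT.
  have jU : sym j \in ~: s.
    rewrite inE; apply: contraL st => js; apply/subsetPn; exists (sym j) => //.
    by rewrite tE !inE eqxx.
  (* The minima divide [a], hence lie in [M]; the maxima are a multiple of [set_exponent a j], hence
     do not. *)
  have [a0 a0U] := exists_min aU; have [b0 b0U] := exists_max aU.
  exists a0, b0; split => //.
    apply: M_dvd aM; apply/forallP => k; have [_] := is_minP _ _ a0U; apply.
    exact: aU.
  apply: contraNN ajM; apply: M_dvd; apply/forallP => k; rewrite ffunE.
  have [_ maxb] := is_maxP _ _ b0U.
  by case: dfwithP => [|k' _]; apply: maxb; rewrite ?jU ?aU.
have ab i : a i <= b i by apply: Ua.
pose w k : cmonomial c := [ffun i : 'I_m => if i < k then b i else a i].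
have w0 : w 0 = a by apply/ffunP => i; rewrite ffunE.
have wm : w m = b by apply/ffunP => i; rewrite ffunE ltn_ord.
have [k [km wk wk1]] : exists k, [/\ k < m, w k \in M & w k.+1 \notin M].
  suff H n : n <= m -> w n \notin M ->
      exists k, [/\ k < m, w k \in M & w k.+1 \notin M].
    by apply: (H m) => //; rewrite wm.
  elim: n => [|n IHn] nm wn; first by rewrite w0 aM in wn.
  have [wnM|wnM] := boolP (w n \in M); first by exists n.
  by apply: IHn => //; apply: ltnW.
pose i := Ordinal km.
have wkU j : sym (w k j) \in ~: s by rewrite ffunE; case: ifP; rewrite ?aU ?bU.
have wE : w k.+1 = set_exponent (w k) (b i).
  apply/ffunP => j; rewrite !ffunE; case: dfwithP => [|j' ij]; first by rewrite ltnSn.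
  rewrite ffunE ltnS leq_eqVlt; case: eqP => //= jk.
  by case/eqP: ij; apply: val_inj.
rewrite inE; apply/existsP; exists (Fc (w k) :\ sym (b i)); apply/andP; split.
  rewrite inE; apply/existsP; exists (w k); rewrite wk.
  apply/existsP; exists i; apply/existsP; exists (b i).
  rewrite -wE wk1 eqxx !andbT ffunE ltnn ltn_neqAle ab andbT.
  apply: contraNneq wk1 => abi; suff -> : w k.+1 = w k by [].
  rewrite wE; apply/ffunP => j; rewrite !ffunE; case: dfwithP => [|j' _].
    by rewrite ltnn; apply/val_inj.
  by rewrite ffunE.
apply/subsetP => u us; rewrite !inE; apply/andP; split.
  by apply: contraL us => /eqP->; have := bU i; rewrite inE.
apply: contraL us => /imsetP[j _ ->]; by have := wkU j; rewrite inE.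
Qed.

Local Open Scope ring_scope.

(** The minima divide the maxima, so the difference is 1 exactly when only the minima lie in [M],
    and 0 otherwise. If [U] misses some X_i, both sums vanish. *)
Lemma Bier_count (R : nzRingType) U :
  (~: U \in Bier M)%:R =
  \sum_(a in M) (is_min U a)%:R - \sum_(a in M) (is_max U a)%:R :> R.
Proof.
have [/existsP[a0 a0U]|/existsPn none] := boolP [exists a, is_min U a]; last first.
  have noneU a : ~ forall i, sym (a i) \in U.
    by case/exists_min => b bU; have := none b; rewrite bU.
  rewrite !big1; last first.
  - by move=> a _; case: is_minP => // -[/noneU].
  - by move=> a _; case: is_maxP => // -[/noneU].
  rewrite subr0; case: in_Bier => //= -[a [b []]]; rewrite setCK.
  by move=> aU; have := none a; rewrite aU.
have [a0i Ua0] := is_minP _ _ a0U; have [b0 b0U] := exists_max a0i.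
have [_ Ub0] := is_maxP _ _ b0U.
have sum1 (D : pred (cmonomial c)) (d : cmonomial c) :
    D d -> (forall a, D a -> a = d) ->
    \sum_(a in M) (D a)%:R = (d \in M)%:R :> R.
  move=> Dd Du; have [dM|dM] := boolP (d \in M).
    rewrite (bigD1 d) //= Dd big1 ?addr0 // => a /andP[_ ad].
    by case: (boolP (D a)) => // /Du adE; rewrite adE eqxx in ad.
  rewrite big1 // => a aM; case: (boolP (D a)) => // /Du adE.
  by rewrite adE (negPf dM) in aM.
rewrite (sum1 _ a0) //; last by move=> a aU; apply: is_min_uniq aU a0U.
rewrite (sum1 _ b0) //; last by move=> b bU; apply: is_max_uniq bU b0U.
have b0a0 : b0 \in M -> a0 \in M.
  by apply: M_dvd; apply/forallP => i; apply: Ub0.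
have -> : (~: U \in Bier M) = (a0 \in M) && (b0 \notin M).
  apply/in_Bier/andP => [[a [b []]]|[a0M b0M]]; last by exists a0, b0; rewrite setCK.
  by rewrite setCK => /is_min_uniq-/(_ _ a0U)-> /is_max_uniq-/(_ _ b0U)->.
case: (a0 \in M) b0a0; case: (b0 \in M) => /= b0a0; rewrite ?subrr ?subr0 //.
by have := b0a0 isT.
Qed.

End Multicomplex.

Local Open Scope ring_scope.

(** Here [U] is the set of the [m] symbols of [a] together with an arbitrary subset of [B]; this
    covers prescribed minima and prescribed maxima alike. *)
Lemma sum_around (R : comNzRingType) a (B : {set cvertex c})
    (Q : pred {set cvertex c}) (x : R) :
  (forall i, sym (a i) \notin B) ->
  (forall U, reflect ((forall i, sym (a i) \in U) /\
     forall i (j : 'I_(c i).+1), sym j \in U -> j = a i \/ sym j \in B) (Q U)) ->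
  \sum_(U | Q U) x ^+ (#|U| - m) = (1 + x) ^+ #|B|.
Proof.
move=> aB QP; pose A := [set sym (a i) | i : 'I_m].
have cA : #|A| = m.
  by rewrite card_imset ?card_ord // => i j /(congr1 (@tag _ _)).
have AB : [disjoint A & B].
  rewrite disjoint_subset; apply/subsetP => _ /imsetP[i _ ->].
  by rewrite inE; apply: aB.
rewrite -(sum_interval_expr x AB) cA; apply: eq_bigl => U.
apply/QP/andP => [[aU Ua]|[/subsetP AU /subsetP UAB]].
  split; first by apply/subsetP => _ /imsetP[i _ ->].
  apply/subsetP => -[i j] /Ua; rewrite inE => -[->|->]; last by rewrite orbT.
  by rewrite (imset_f (fun i => sym (a i))).
split=> [i|i j /UAB]; first by apply: AU; rewrite (imset_f (fun i => sym (a i))).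
rewrite inE => /orP[/imsetP[k _ E]|->]; [left|by right].
have ik : i = k by move/(congr1 (@tag _ _)): E.
by subst k; apply: (eq_from_Tagged E).
Qed.

Lemma sum_is_min (R : comNzRingType) a (x : R) :
  \sum_(U | is_min U a) x ^+ (#|U| - m) = (1 + x) ^+ (deg_max - deg a).
Proof.
pose B := [set u : cvertex c | (a (tag u) < tagged u)%N].
rewrite (@sum_around _ a B) => [|i|U]; last 2 first.
- by rewrite inE ltnn.
- apply: (iffP (is_minP U a)) => -[aU Ua]; split=> // i j /Ua.
    rewrite inE /= leq_eqVlt => /orP[/eqP ij|]; [left|by right].
    exact/val_inj.
  by rewrite inE => -[->|/ltnW].
rewrite (@card_cvertex_set (fun i j => a i < j)%N) deg_maxB.
by under eq_bigr do rewrite card_ord_gt subSS.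
Qed.

Lemma sum_is_max (R : comNzRingType) a (x : R) :
  \sum_(U | is_max U a) x ^+ (#|U| - m) = (1 + x) ^+ deg a.
Proof.
pose B := [set u : cvertex c | (tagged u < a (tag u))%N].
rewrite (@sum_around _ a B) => [|i|U]; last 2 first.
- by rewrite inE ltnn.
- apply: (iffP (is_maxP U a)) => -[aU Ua]; split=> // i j /Ua.
    rewrite inE /= leq_eqVlt => /orP[/eqP ij|]; [left|by right].
    exact/val_inj.
  by rewrite inE => -[->|/ltnW].
rewrite (@card_cvertex_set (fun i j => j < a i)%N).
by congr (_ ^+ _); apply: eq_bigr => i _; rewrite card_ord_lt // ltnW.
Qed.

Section Numbers.

Variables (M : {set cmonomial c}).
Hypothesis M_dvd : forall a b, cdvd a b -> b \in M -> a \in M.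
Hypothesis M_proper : M != setT.
Hypothesis M_neq0 : M != set0.

Lemma zero_in : [ffun=> ord0] \in M.
Proof.
have /set0Pn[a aM] := M_neq0; apply: M_dvd aM; apply/forallP => i.
by rewrite ffunE.
Qed.

Lemma max_notin : [ffun=> ord_max] \notin M.
Proof.
have [a aM] : exists a, a \notin M.
  apply/existsP; apply: contraNT M_proper => /existsPn aM.
  by apply/eqP/setP => a; rewrite inE; apply/negPn/aM.
apply: contraNN aM; apply: M_dvd; apply/forallP => i.
by rewrite ffunE -ltnS /=.
Qed.

Lemma set0_in_Bier : set0 \in Bier M.
Proof.
apply/(in_Bier M_dvd); exists [ffun=> ord0], [ffun=> ord_max]; rewrite setC0.
split; [apply/is_minP|apply/is_maxP|exact: zero_in|exact: max_notin];
  split=> [i|i j _]; rewrite ?inE // ffunE //=.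
by rewrite -ltnS.
Qed.

Lemma rank_Bier : rank_complex (Bier M) = deg_max.-1.
Proof.
have cF t : t \in Bier_facets M -> #|t| = deg_max.-1.
  move/card_Bier_facets => ->; rewrite card_cvertex.
  by rewrite addnC subnS addKn.
apply/eqP; rewrite eqn_leq; apply/andP; split.
  apply/bigmax_leqP => s; rewrite inE => /existsP[t /andP[/cF <- st]].
  exact: subset_leq_card.
have := set0_in_Bier; rewrite inE => /existsP[t /andP[tF _]].
rewrite -(cF t tF); apply: card_le_rank.
by rewrite inE; apply/existsP; exists t; rewrite tF /=.
Qed.

Lemma deg_max_gt0 : (0 < deg_max)%N.
Proof.
rewrite lt0n; apply: contraNneq max_notin => d0.
suff <- : [ffun=> ord0] = [ffun=> ord_max] :> cmonomial c by apply: zero_in.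
apply/ffunP => i; rewrite !ffunE; apply/val_inj => /=.
have := leq_deg_max [ffun=> ord_max]; rewrite d0 leqn0 sum_nat_eq0.
by move/forallP/(_ i); rewrite ffunE => /eqP.
Qed.

(** The extra factor [x] appears because a face of size k with complement [U] has
    [n - k + 1 = #|U| - m]. *)
Lemma Bier_h_poly (R : comNzRingType) (x : R) :
  let n := rank_complex (Bier M) in
  x * (\sum_(i < n.+1) x ^+ (n - i) *+ fnum (Bier M) i) =
  \sum_(a in M) (1 + x) ^+ (deg_max - deg a) - \sum_(a in M) (1 + x) ^+ deg a.
Proof.
move=> n; have sn s : s \in Bier M -> (#|s| <= n)%N.
  exact: card_le_rank.
rewrite (sum_by_value (fun i => x ^+ (n - i)) sn) mulr_sumr.
transitivity (\sum_(U : {set cvertex c}) (~: U \in Bier M)%:R * x ^+ (#|U| - m)).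
  rewrite (reindex_inj (can_inj setCK)) /= big_mkcond /=; apply: eq_bigr => U _.
  case: (boolP (_ \in _)) => [UB|_]; last by rewrite mul0r.
  rewrite -exprS mul1r; congr (_ ^+ _).
  have := sn _ UB; rewrite /n rank_Bier; have := deg_max_gt0.
  have := cardsC U; rewrite card_cvertex => E d0 le; rewrite -subSn // prednK //.
  have -> : deg_max = (#|U| + #|~: U| - m)%N by rewrite E addnK.
  by rewrite subnAC addnK.
under eq_bigr do rewrite (Bier_count M_dvd) mulrBl !mulr_suml.
rewrite sumrB; congr (_ - _); rewrite exchange_big /=; apply: eq_bigr => a _.
  rewrite -sum_is_min [RHS]big_mkcond /=; apply: eq_bigr => U _.
  by case: ifP; rewrite ?mul1r ?mul0r.
rewrite -sum_is_max [RHS]big_mkcond /=; apply: eq_bigr => U _.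
by case: ifP; rewrite ?mul1r ?mul0r.
Qed.

End Numbers.
End Murai.

Lemma flag_small_nonface (T : finType) (L : {set {set T}}) s :
  flag L -> s \notin L ->
  exists t : {set T}, [/\ t \subset s, t \notin L & #|t| <= 2].
Proof.
move=> flagL sL; have [t mint ts] := @minset_exists T (fun t => t \notin L) s sL.
by exists t; split=> //; [case/minsetP: mint|apply: flagL].
Qed.

(** * Flag Murai spheres *)

Section FlagMurai.

Variables (m : nat) (c : 'I_m -> nat) (M : {set cmonomial c}).
Hypothesis c_gt0 : forall i, 0 < c i.
Hypothesis M_dvd : forall a b, cdvd a b -> b \in M -> a \in M.
Hypothesis M_proper : M != setT.
Hypothesis M_neq0 : M != set0.
Hypothesis flagM : flag (Bier M).
Implicit Types (a b : cmonomial c).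

Definition expo a (i : 'I_m) : nat := a i.
(** Clipping at [c] extends membership in [M] to a monotone predicate on all exponent vectors, as
    the results on [P] require. *)
Definition trunc (f : 'I_m -> nat) : cmonomial c :=
  [ffun i => inord (minn (f i) (c i))].
Definition member (f : 'I_m -> nat) := trunc f \in M.
Definition core :=
  [set i | [exists a in M, set_exponent a (@ord_max (c i)) \notin M]].

Lemma truncE f i : trunc f i = minn (f i) (c i) :> nat.
Proof. by rewrite ffunE inordK // ltnS geq_minr. Qed.

Lemma trunc_id f i : pw_le f c -> trunc f i = f i :> nat.
Proof. by move=> fc; rewrite truncE; apply/minn_idPl. Qed.

Lemma cmonomial_le a : pw_le (expo a) c.
Proof. by move=> i; rewrite -ltnS; apply: ltn_ord. Qed.

Lemma truncK a : trunc (expo a) = a.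
Proof. by apply/ffunP => i; apply/val_inj/trunc_id/cmonomial_le. Qed.

Lemma memberE a : member (expo a) = (a \in M).
Proof. by rewrite /member truncK. Qed.

Lemma member_le f g : pw_le f g -> member g -> member f.
Proof.
move=> fg; apply: M_dvd; apply/forallP => i; rewrite !truncE.
by have := fg i; nat_lia.
Qed.

Lemma member0 : member (fun=> 0).
Proof.
rewrite /member (_ : trunc _ = [ffun=> ord0]); first exact: zero_in.
by apply/ffunP => i; apply/val_inj; rewrite /= truncE ffunE min0n.
Qed.

Lemma member_max : ~~ member c.
Proof.
rewrite /member (_ : trunc _ = [ffun=> ord_max]); first exact: max_notin.
by apply/ffunP => i; apply/val_inj; rewrite /= truncE ffunE minnn.
Qed.

(** The symbols strictly below [b] form a nonface, so they contain a nonface [t] of size at most 2.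
    The complement of [t] has maxima [c], so its minima must lie outside [M]; all symbols below
    these minima are in [t], which bounds their degree. *)
Lemma nonmember_small (b : 'I_m -> nat) : ~~ member b -> pw_le b c ->
  exists g, [/\ pw_le g b, ~~ member g & \sum_i g i <= 2].
Proof.
move=> bM bc; pose s := [set u : cvertex c | tagged u < trunc b (tag u)].
have sB : s \notin Bier M.
  apply/(in_Bier M_dvd) => -[a [_ [/is_minP[aU _] _ aM _]]].
  case/negP: bM; apply: M_dvd aM; apply/forallP => i.
  by have := aU i; rewrite !inE -leqNgt.
have [t [ts tB t2]] := flag_small_nonface flagM sB.
have outs i (j : 'I_(c i).+1) : trunc b i <= j -> sym j \in ~: t.
  move=> bj; rewrite inE; apply/negP => /(subsetP ts).
  by rewrite inE /= ltnNge bj.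
have maxU : is_max (~: t) [ffun=> ord_max].
  apply/is_maxP; split=> [i|i j _]; rewrite ffunE; last by rewrite -ltnS.
  by apply: outs; rewrite -ltnS.
have [a aU] := exists_min (fun i => outs i (trunc b i) (leqnn _)).
have [_ Ua] := is_minP _ _ aU.
exists (expo a); split.
- by move=> i; rewrite -(trunc_id i bc); apply/Ua/outs.
- rewrite memberE; apply/negP => aM; case/negP: tB.
  by apply/(in_Bier M_dvd); exists a, [ffun=> ord_max]; rewrite max_notin.
- apply: leq_trans t2.
  rewrite [leqLHS](_ : _ = #|[set u : cvertex c | tagged u < a (tag u)]|).
    apply/subset_leq_card/subsetP => -[i j]; rewrite inE /= ltnNge.
    by apply: contraNT => jt; apply: Ua; rewrite inE.
  rewrite (@card_cvertex_set _ _ (fun i j => j < a i)).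
  by apply: eq_bigr => i _; rewrite card_ord_lt // ltnW.
Qed.

(** Dual to [nonmember_small]: [t] consists of symbols strictly above [a], and [b] is the maxima of
    its complement. *)
Lemma member_large (a : 'I_m -> nat) : member a -> pw_le a c ->
  exists b : 'I_m -> nat,
    [/\ pw_le a b, pw_le b c, member b & \sum_i (c i - b i) <= 2].
Proof.
move=> aM ac; pose s := [set u : cvertex c | trunc a (tag u) < tagged u].
have sB : s \notin Bier M.
  apply/(in_Bier M_dvd) => -[_ [b [_ /is_maxP[bU _] _ /negP[]]]].
  apply: M_dvd aM; apply/forallP => i.
  by have := bU i; rewrite !inE -leqNgt.
have [t [ts tB t2]] := flag_small_nonface flagM sB.
have outs i (j : 'I_(c i).+1) : j <= trunc a i -> sym j \in ~: t.
  move=> bj; rewrite inE; apply/negP => /(subsetP ts).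
  by rewrite inE /= ltnNge bj.
have minU : is_min (~: t) [ffun=> ord0].
  by apply/is_minP; split=> [i|i j _]; rewrite ffunE //; apply: outs.
have [b bU] := exists_max (fun i => outs i (trunc a i) (leqnn _)).
have [_ Ub] := is_maxP _ _ bU.
exists (expo b); split.
- by move=> i; rewrite -(trunc_id i ac); apply/Ub/outs.
- exact: cmonomial_le.
- rewrite memberE; apply/negPn/negP => bM; case/negP: tB.
  by apply/(in_Bier M_dvd); exists [ffun=> ord0], b; rewrite zero_in.
- apply: leq_trans t2.
  rewrite [leqLHS](_ : _ = #|[set u : cvertex c | b (tag u) < tagged u]|).
    apply/subset_leq_card/subsetP => -[i j]; rewrite inE /= ltnNge.
    by apply: contraNT => jt; apply: Ub; rewrite inE.
  rewrite (@card_cvertex_set _ _ (fun i j => b i < j)).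
  by apply: eq_bigr => i _; rewrite card_ord_gt subSS.
Qed.

Lemma set_exponentE a i (j : 'I_(c i).+1) k :
  set_exponent a j k = upd (expo a) i j k :> nat.
Proof.
by rewrite ffunE /upd; case: dfwithP => [|k' ik]; rewrite ?eqxx // eq_sym (negPf ik).
Qed.

Lemma trunc_upd a i : trunc (upd (expo a) i (c i)) = set_exponent a (@ord_max (c i)).
Proof.
apply/ffunP => k; apply/val_inj; rewrite /= set_exponentE trunc_id // => l.
by rewrite /upd; case: eqP => [->|_]; last exact: cmonomial_le.
Qed.

Lemma coreP i : reflect
  (exists f, [/\ pw_le f c, member f & ~~ member (upd f i (c i))]) (i \in core).
Proof.
rewrite inE; apply: (iffP exists_inP) => [[a aM aiM]|[f [fc fM fiM]]].
  exists (expo a); split; first exact: cmonomial_le.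
    by rewrite memberE.
  by rewrite /member trunc_upd.
exists (trunc f) => //; rewrite -trunc_upd; apply: contraNN fiM.
apply: member_le => k; rewrite /upd; case: eqP => // _.
by rewrite /expo trunc_id.
Qed.

Lemma free_cone a i (j : 'I_(c i).+1) :
  i \notin core -> a \in M -> set_exponent a j \in M.
Proof.
move=> iK aM.
have: set_exponent a (@ord_max (c i)) \in M.
  by apply: contraNT iK => aiM; rewrite inE; apply/exists_inP; exists a.
apply: M_dvd; apply/forallP => k; rewrite !set_exponentE /upd.
by case: eqP => // _; rewrite -ltnS.
Qed.

(** The whole of X_i is a nonface. If a subset [t] of it omits a symbol, [free_cone] shows that the
    minima of the complement lie in [M] and the maxima do not, so [t] is a face. Flagness then
    bounds the size [c i + 1] of X_i by 2. *)
Lemma free_c i : i \notin core -> c i = 1.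
Proof.
move=> iK; apply/eqP; rewrite eqn_leq c_gt0 andbT -ltnS.
pose s := [set u : cvertex c | tag u == i].
have sB : s \notin Bier M.
  apply/(in_Bier M_dvd) => -[a [_ [/is_minP[/(_ i) + _] _ _ _]]].
  by rewrite !inE /= eqxx.
have [t [ts tB t2]] := flag_small_nonface flagM sB.
suff st : s \subset t.
  apply: leq_trans t2; apply: leq_trans (subset_leq_card st).
  rewrite -(card_ord (c i).+1) -(card_image (f := @sym m c i)); last first.
    by move=> j k E; apply: (eq_from_Tagged E).
  by apply/subset_leq_card/subsetP => _ /imageP[j _ ->]; rewrite inE.
apply/subsetP => -[k j]; rewrite inE /= => /eqP ki; subst k.
apply: contraNT tB => jt.
have out k (l : 'I_(c k).+1) : k != i -> sym l \in ~: t.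
  by move=> ki; rewrite inE; apply: contraNN ki => /(subsetP ts); rewrite inE.
have zU k : sym (set_exponent [ffun=> ord0] j k) \in ~: t.
  rewrite ffunE; case: dfwithP => [|k' ik]; first by rewrite inE.
  by apply: out; rewrite eq_sym.
have [a aU] := exists_min zU; have [b bU] := exists_max zU.
have [_ Ua] := is_minP _ _ aU; have [_ Ub] := is_maxP _ _ bU.
apply/(in_Bier M_dvd); exists a, b; split=> //.
  have := free_cone j iK (zero_in M_dvd M_neq0); apply: M_dvd.
  by apply/forallP => k; apply/Ua.
apply: contraNN (max_notin M_dvd M_proper) => /(free_cone (@ord_max (c i)) iK).
apply: M_dvd; apply/forallP => k; rewrite set_exponentE /upd ffunE.
by case: eqP => [->//|/eqP ki]; apply/Ub/out.
Qed.

(** * Counting the members in the core variables *)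

Local Notation N := (core_deg c core).

Lemma flag_core_deg_le4 : N <= 4.
Proof.
exact: core_deg_le4 c_gt0 member_le member0 nonmember_small member_large coreP.
Qed.

Definition core_part :=
  [set a in M | [forall i, (i \notin core) ==> (a i == 0 :> nat)]].

Lemma core_partP a :
  reflect (a \in M /\ forall i, i \notin core -> a i = 0 :> nat) (a \in core_part).
Proof.
rewrite inE; apply: (iffP andP) => -[aM].
  by move/forallP => a0; split=> // i iK; apply/eqP; have := a0 i; rewrite iK.
by move=> a0; split=> //; apply/forallP => i; apply/implyP => /a0->.
Qed.

Lemma sum_core_codeg a :
  a \in core_part -> \sum_(i in core) (c i - a i) + deg a = N.
Proof.
case/core_partP => _ a0; have -> : deg a = \sum_(i in core) a i.
  by rewrite /deg (bigID [in core]) /= [X in _ + X]big1 ?addn0 // => i /a0.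
by rewrite -big_split /=; apply: eq_bigr => i _; rewrite subnK // -ltnS.
Qed.

(** Degree [N] would make [a] agree with [c] on the core, and [P_core] would put x^c in [M]. *)
Lemma core_part_deg_lt a : a \in core_part -> deg a < N.
Proof.
move=> aC; have := sum_core_codeg aC; case/core_partP: aC => aM a0.
have [/eqP|] := posnP (\sum_(i in core) (c i - a i)); last by nat_lia.
rewrite sum_nat_eq0 => /forall_inP full _.
case/negP: (member_max); have: member (expo a) by rewrite memberE.
apply: (P_core member_le coreP) => // [|i iK]; first exact: cmonomial_le.
by apply/eqP; rewrite eqn_leq cmonomial_le -subn_eq0 full.
Qed.

Lemma core_part_corank1 a : a \in core_part -> (deg a).+1 = N ->
  exists i, [/\ i \in core, member (corank1 c i), a i = (c i).-1 :> nat
    & forall k, k \in core -> k != i -> a k = c k :> nat].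
Proof.
move=> aC aN; have := sum_core_codeg aC; case/core_partP: aC => aM a0 S1.
have {}S1 : \sum_(i in core) (c i - a i) = 1 by nat_lia.
have [/exists_inP[i iK ai]|/exists_inPn none] :=
    boolP [exists i in core, 0 < c i - a i]; last first.
  by rewrite big1 // in S1 => i /none; rewrite -eqn0Ngt => /eqP.
have ac k : a k <= c k by apply: cmonomial_le.
have aik : a i = (c i).-1 :> nat.
  by rewrite (bigD1 i) //= in S1; have := ac i; nat_lia.
have ak k : k \in core -> k != i -> a k = c k :> nat.
  move=> kK ki; rewrite (bigD1 i) //= (bigD1 k) /= ?kK // in S1.
  by have := ac k; nat_lia.
exists i; split=> //; have: member (expo a) by rewrite memberE.
apply: (P_core member_le coreP) => [|k|k kK]; first exact: cmonomial_le.
  by rewrite /corank1; case: eqP => // _; apply: leq_pred.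
by rewrite /corank1; case: eqP => [->|/eqP]; [exact: aik|exact: ak].
Qed.

Definition variable i : cmonomial c := trunc (e1 i).

Lemma variable_core i :
  i \in core -> member (e1 i) -> variable i \in [set a in core_part | deg a == 1].
Proof.
move=> iK iM; have vE k : variable i k = (k == i) :> nat.
  by rewrite truncE; apply/minn_idPl; apply: leq_trans (leq_b1 _) (c_gt0 _).
rewrite inE; apply/andP; split.
  apply/core_partP; split=> // k; rewrite vE.
  by case: eqP => // ->; rewrite iK.
rewrite /deg (eq_bigr _ (fun k _ => vE k)) (bigD1 i) //= eqxx big1 // => k.
by move/negPf->.
Qed.

Lemma variable_inj : injective variable.
Proof.
move=> i k /ffunP/(_ i)/(congr1 val) /=; rewrite !truncE /e1 eqxx.
by have := c_gt0 i; case: (eqVneq i k) => //= _; nat_lia.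
Qed.

Definition core_num k := #|[set a in core_part | deg a == k]|.

Lemma core_num0 : core_num 0 = 1.
Proof.
rewrite /core_num -(cards1 ([ffun=> ord0] : cmonomial c)); apply: eq_card => a.
rewrite !inE sum_nat_eq0; apply/idP/eqP => [/andP[_ /forallP a0]|->].
  by apply/ffunP => i; apply/val_inj/eqP; rewrite ffunE; exact: a0.
rewrite zero_in //=; apply/andP; split; apply/forallP => i; rewrite ffunE //=.
exact: implybT.
Qed.

Lemma core_num1_gt0 : 2 < N -> 0 < core_num 1.
Proof.
case/(core_e1 member_le member0 member_large) => i iK /(variable_core iK) vC.
by apply/card_gt0P; exists (variable i).
Qed.

Lemma core_num1_gt1 i k : i \in core -> k \in core -> k != i ->
  member (e1 i) -> member (e1 k) -> 1 < core_num 1.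
Proof.
move=> iK kK ki /(variable_core iK) vi /(variable_core kK) vk.
apply/card_gt1P; exists (variable i), (variable k); split=> //.
by rewrite (inj_eq variable_inj) eq_sym.
Qed.

(** Degree 2 is codegree one here: [core_corank1_uniq] allows at most one such element, and if it
    exists, [core_corank1] provides two variables. *)
Lemma core_num2 : N = 3 -> core_num 2 < core_num 1.
Proof.
move=> N3; have [|C2] := leqP (core_num 2) 0.
  by move=> C0; apply: leq_ltn_trans C0 (core_num1_gt0 _); rewrite N3.
have le1 : core_num 2 <= 1.
  rewrite leqNgt; apply/negP => /card_gt1P[a [b []]].
  rewrite !inE -!andbA => /and3P[aM aC /eqP a2] /and3P[bM bC /eqP b2].
  have [||i [iK iM ai aK]] := @core_part_corank1 a; rewrite ?inE ?aM ?a2 ?N3 //.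
  have [||k [kK kM bk bK]] := @core_part_corank1 b; rewrite ?inE ?bM ?b2 ?N3 //.
  have [ik|ik] := eqVneq i k; last first.
    have := core_corank1_uniq c_gt0 member_le nonmember_small coreP iM kM ik iK.
    by rewrite N3.
  subst k; case/eqP; apply/ffunP => l; apply/val_inj => /=.
  have [lK|lK] := boolP (l \in core).
    have [->|li] := eqVneq l i; first by rewrite ai bk.
    by rewrite aK // bK.
  have /forallP/(_ l) := aC; have /forallP/(_ l) := bC.
  by rewrite lK /= => /eqP-> /eqP->.
have /card_gt0P[a] := C2; rewrite inE => /andP[aC /eqP a2].
have [||i [iK iM _ _]] := @core_part_corank1 a; rewrite ?a2 ?N3 //.
have [|_ [k kK [ki Pi Pk]]] :=
  core_corank1 c_gt0 member_le nonmember_small member_large coreP iK iM.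
  by rewrite N3.
by apply: leq_ltn_trans le1 (core_num1_gt1 iK kK ki Pi Pk).
Qed.

(** Degree 3 is codegree one here, which [core_corank1] permits only for [N <= 3]; so
    [core_num 3 = 0], and [core_e1_two] provides two variables. *)
Lemma core_num3 : N = 4 -> core_num 3 + 1 < core_num 1.
Proof.
move=> N4; rewrite (_ : core_num 3 = 0).
  have [|i [k [iK kK ki Pi Pk]]] :=
    core_e1_two c_gt0 member_le member0 nonmember_small member_large coreP.
    by rewrite N4.
  exact: core_num1_gt1 iK kK ki Pi Pk.
apply/eqP; rewrite cards_eq0; apply/eqP/setP => a; rewrite [RHS]inE.
apply/negP; rewrite inE => /andP[aC /eqP a3].
have [||i [iK iM _ _]] := @core_part_corank1 a; rewrite ?a3 ?N4 //.
have [|+ _] := core_corank1 c_gt0 member_le nonmember_small member_large coreP iK iM.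
  by rewrite N4.
by rewrite N4.
Qed.

Lemma deg_max_core : deg_max c = N + #|~: core|.
Proof.
rewrite /deg_max (bigID [in core]) /=; congr (_ + _); rewrite -sum1_card.
by apply: eq_big => [i|i /free_c//]; rewrite in_setC.
Qed.

(** * Splitting off the free variables *)

Definition restrict a : cmonomial c := [ffun i => if i \in core then a i else ord0].
Definition extend a (S : {set 'I_m}) : cmonomial c :=
  [ffun i => if i \in S then ord_max else a i].

Lemma restrict_core a : a \in M -> restrict a \in core_part.
Proof.
move=> aM; apply/core_partP; split=> [|i /negPf iK]; last by rewrite ffunE iK.
by apply: M_dvd aM; apply/forallP => i; rewrite ffunE; case: ifP.
Qed.

Lemma deg_extend a (S : {set 'I_m}) :
  a \in core_part -> S \subset ~: core -> deg (extend a S) = deg a + #|S|.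
Proof.
case/core_partP => _ a0 /subsetP SK.
rewrite -sum1_card [X in _ + X]big_mkcond -big_split /=.
apply: eq_bigr => i _; rewrite ffunE; case: ifPn => [/SK|_]; last by rewrite addn0.
by rewrite in_setC => iK; rewrite a0 //= free_c.
Qed.

(** An element of [M] amounts to its restriction to the core and the set [S] of free variables
    dividing it, since [c i = 1] for those; by [P_core] every such pair occurs. *)
Lemma sum_core_part (R : nmodType) (F : nat -> R) :
  (\sum_(a in M) F (deg a) = \sum_(a in core_part)
     \sum_(S : {set 'I_m} | S \subset ~: core) F (deg a + #|S|)%N)%R.
Proof.
rewrite (partition_big restrict [in core_part]) /=; last exact: restrict_core.
apply: eq_bigr => a aC; have [aM a0] := core_partP _ aC.
rewrite (reindex_onto (extend a) (fun b => [set i in ~: core | 0 < b i])) /=.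
  have cond S : [&& extend a S \in M, restrict (extend a S) == a &
      [set i in ~: core | 0 < extend a S i] == S] = (S \subset ~: core).
    apply/and3P/idP => [[_ _ /eqP<-]|/subsetP SK].
      by apply/subsetP => i; rewrite in_set => /andP[].
    have SK' i : i \in core -> i \in S = false.
      by move=> iK; apply/negP => /SK; rewrite in_setC iK.
    split.
    - rewrite -memberE; have: member (expo a) by rewrite memberE.
      apply: (P_core member_le coreP) => [||i iK]; try exact: cmonomial_le.
      by rewrite /expo ffunE SK'.
    - apply/eqP/ffunP => i; rewrite !ffunE; case: ifPn => [/SK'->//|/a0 ai].
      by apply/val_inj; rewrite /= ai.
    - apply/eqP/setP => i; rewrite in_set in_setC ffunE.
      have [/SK'->|iK] //= := boolP (i \in core).
      by case: ifP => _ /=; [exact: c_gt0|rewrite a0].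
  rewrite (eq_bigl _ _ (fun S => etrans (esym (andbA _ _ _)) (cond S))).
  by apply: eq_bigr => S SK; rewrite deg_extend.
move=> b /andP[bM /eqP bE]; apply/ffunP => i; rewrite ffunE in_set in_setC -bE ffunE.
have [//|iK] /= := boolP (i \in core).
have ci := free_c iK; have b1 : b i <= 1 by rewrite -ci -ltnS.
apply/val_inj; have [bi|bi] := posnP (b i); first by rewrite /= bi.
by rewrite /=; nat_lia.
Qed.

Lemma sum_core_part_expr (R : comNzRingType) (t : R) :
  (\sum_(a in M) t ^+ (deg_max c - deg a) - \sum_(a in M) t ^+ deg a =
   (1 + t) ^+ #|~: core| *
     \sum_(a in core_part) (t ^+ (N - deg a) - t ^+ deg a))%R.
Proof.
have sub t' : (\sum_(S : {set 'I_m} | S \subset ~: core) t' ^+ #|S| =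
    (1 + t') ^+ #|~: core| :> R)%R.
  have d0 : [disjoint (set0 : {set 'I_m}) & ~: core] by rewrite -setI_eq0 set0I.
  rewrite -(sum_interval_expr t' d0); apply: eq_big => S; rewrite ?set0U ?sub0set //.
  by rewrite cards0 subn0.
rewrite (sum_core_part (fun d => t ^+ (deg_max c - d))%R).
rewrite (sum_core_part (fun d => t ^+ d)%R) -sumrB mulr_sumr.
apply: eq_bigr => a aC; rewrite mulrBr; congr (_ - _)%R; last first.
  by under eq_bigr do rewrite exprD; rewrite -mulr_sumr sub mulrC.
(* Complementing [S] among the free variables turns the codegree into [N - deg a + #|S|]. *)
rewrite (reindex_onto (fun S => ~: core :\: S) (fun S => ~: core :\: S)) /=;
  last first.
  by move=> S SK; rewrite setDDr setDv set0U; apply/setIidPr.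
rewrite -sub mulrC mulr_sumr; apply: eq_big => S.
  rewrite subsetDl setDDr setDv set0U /=.
  by apply/eqP/idP => [<-|/setIidPr//]; apply: subsetIl.
move=> /andP[_ /eqP SE]; rewrite -exprD; congr (_ ^+ _)%R.
have SK : S \subset ~: core by rewrite -SE subsetDl.
rewrite deg_max_core cardsDS //; move: (subset_leq_card SK) (core_part_deg_lt aC).
by move: #|~: core| #|S| (deg a) N => u v d n; lia.
Qed.

(** Degrees k and [N - k] enter with opposite signs, so the middle degree drops out for even [N]. By
    [core_num2] and [core_num3] the truncated differences defining [g] are exact; the first clause
    makes the truncated [N - 3] harmless. *)
Lemma core_part_gamma : exists g : nat, (g = 0 \/ 2 < N) /\
  forall (R : comNzRingType) (t : R),
  (\sum_(a in core_part) (t ^+ (N - deg a) - t ^+ deg a) =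
   (t - 1) * ((1 + t) ^+ N.-1 + g%:R * t * (1 + t) ^+ (N - 3)))%R.
Proof.
have sumE (R : comNzRingType) (t : R) n : N = n.+1 ->
    (\sum_(a in core_part) (t ^+ (N - deg a) - t ^+ deg a) =
     \sum_(i < n.+1) (t ^+ (n.+1 - i) - t ^+ i) * (core_num i)%:R)%R.
  move=> Nn; under [RHS]eq_bigr do rewrite mulr_natr.
  rewrite (sum_by_value (fun i => t ^+ (n.+1 - i) - t ^+ i)%R) ?Nn //.
  by move=> a /core_part_deg_lt; rewrite Nn.
have zC : [ffun=> ord0] \in core_part.
  apply/core_partP; split; first exact: zero_in.
  by move=> i _; rewrite ffunE.
have N0 := core_part_deg_lt zC; have N4 := flag_core_deg_le4.
have [n Nn] : exists n, N = n.+1 by exists N.-1; rewrite prednK //; nat_lia.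
case: n Nn => [|[|[|[|n]]]] Nn; last by rewrite Nn in N4.
- exists 0; split=> [|R t]; first by left.
  by rewrite (sumE _ _ _ Nn) Nn big_ord1 core_num0; ring.
- exists 0; split=> [|R t]; first by left.
  rewrite (sumE _ _ _ Nn) Nn !big_ord_recl big_ord0 core_num0 /=.
  by rewrite /bump /= subn1 subrr mul0r; ring.
- exists (core_num 1 - core_num 2).-1; split=> [|R t]; first by right; rewrite Nn.
  rewrite (sumE _ _ _ Nn) Nn !big_ord_recl big_ord0 core_num0 /= /bump /=.
  have := core_num2 Nn; move: (core_num 1) (core_num 2) => q1 q2 q12.
  have [g ->] : exists g, q1 = g + q2 + 1 by exists (q1 - q2).-1; nat_lia.
  rewrite addn1 -addSn addnK /=.
  rewrite !(addn0, add1n, subSS, subn0, subnn).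
  rewrite natrD -[g.+1]addn1 natrD.
  by move: (g%:R : R)%R (q2%:R : R)%R => u v; ring.
- exists (core_num 1 - core_num 3 - 2); split=> [|R t]; first by right; rewrite Nn.
  rewrite (sumE _ _ _ Nn) Nn !big_ord_recl big_ord0 core_num0 /= /bump /=.
  have := core_num3 Nn.
  move: (core_num 1) (core_num 2) (core_num 3) => q1 q2 q3 q13.
  have [g ->] : exists g, q1 = g + q3 + 2 by exists (q1 - q3 - 2); nat_lia.
  rewrite (_ : g + q3 + 2 - q3 - 2 = g); last by lia.
  rewrite !(addn0, add1n, subSS, subn0, subnn).
  rewrite !natrD.
  by move: (g%:R : R)%R (q2%:R : R)%R (q3%:R : R)%R => u v w; ring.
Qed.

Local Open Scope ring_scope.

Lemma Bier_gamma_poly : let n := rank_complex (Bier M) in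
  exists g : nat, (g = 0 \/ 1 < n)%N /\
    \sum_(i < n.+1) ('X - 1%:P : {poly int}) ^+ (n - i) *+ fnum (Bier M) i =
      (1 + 'X) ^+ n + g%:R * 'X * (1 + 'X) ^+ (n - 2).
Proof.
move=> n; have [g [gN gE]] := core_part_gamma; exists g.
have nE : n = (N + #|~: core|).-1 by rewrite /n rank_Bier // deg_max_core.
have N0 : (0 < N)%N.
  apply: leq_ltn_trans (leq0n _) (@core_part_deg_lt [ffun=> ord0] _).
  apply/core_partP; split; first exact: zero_in.
  by move=> i _; rewrite ffunE.
split; first by case: gN => [|N2]; [left|right; rewrite nE; move: N0 N2; lia].
have x0 : 'X - 1%:P != 0 :> {poly int} by rewrite polyXsubC_eq0.
have xE : 1 + ('X - 1%:P) = 'X :> {poly int} by rewrite polyC1 addrC subrK.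
apply: (mulfI x0); rewrite (Bier_h_poly M_dvd M_proper M_neq0) xE.
rewrite sum_core_part_expr gE mulrCA; congr (_ * _).
rewrite mulrDr -exprD nE; congr (_ ^+ _ + _); first by move: N0; lia.
case: gN => [->|N2]; first by rewrite !mul0r mulr0.
rewrite mulrCA -exprD; congr (_ * _ ^+ _); move: N2; lia.
Qed.

End FlagMurai.

(** * From a two-term h-polynomial to the gamma-vector *)

Section TwoTermGamma.

Local Open Scope ring_scope.

Lemma coef_1DXn (R : nzRingType) n i : ((1 + 'X) ^+ n : {poly R})`_i = 'C(n, i)%:R.
Proof.
elim: n i => [|n IHn] i; first by rewrite expr0 coef1 bin0n.
rewrite exprS mulrDl mul1r coefD coefXM !IHn.
by case: i => [|i] /=; rewrite ?bin0 ?addr0 // binS natrD.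
Qed.

(** [hnum] reads the coefficients in reverse order, so the point is that the given polynomial is
    palindromic. *)
Lemma gamma_vector_two_terms (T : finType) (L : {set {set T}}) (g : nat) :
  let n := rank_complex L in (g = 0 \/ 1 < n)%N ->
  \sum_(i < n.+1) ('X - 1%:P : {poly int}) ^+ (n - i) *+ fnum L i =
    (1 + 'X) ^+ n + g%:R * 'X * (1 + 'X) ^+ (n - 2) ->
  gamma_vector L (fun i => if i == 0%N then 1 else if i == 1%N then g%:Z else 0).
Proof.
move=> n gn HE.
split; last first.
  (* Index 1 exceeds [n./2] only if [n <= 1], and then [g = 0]. *)
  rewrite -/n => -[|[|i]] //; case: gn => [->//|]; case: (n) => [|[]] //.
rewrite -/n.
transitivity ((1 + 'X) ^+ n + g%:R * 'X * (1 + 'X) ^+ (n - 2) : {poly int}).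
  have coefG i : ((1 + 'X) ^+ n + g%:R * 'X * (1 + 'X) ^+ (n - 2) : {poly int})`_i
      = 'C(n, i)%:R + (if i == 0 then 0 else g * 'C(n - 2, i.-1))%N%:R.
    rewrite coefD coef_1DXn -mulrA -polyC_natr coefCM coefXM coef_1DXn.
    by case: i => [|i] //=; rewrite ?mulr0 // -natrM.
  apply/polyP => i; rewrite coef_poly /hnum -/n HE !coefG ltnS.
  case: leqP => [lin|ltni].
    rewrite bin_sub //; congr (_ + _%:R); case: gn => [->|n1].
      by rewrite !if_same.
    (* The ends [i = 0] and [i = n] are treated apart because of the truncated [i.-1]. *)
    case: (posnP i) => [->|i0].
      by rewrite subn0 /= (negPf (lt0n_neq0 _)) 1?ltnW // bin_small ?muln0 //; lia.
    case: (eqVneq i n) => [->|ni]; first by rewrite subnn /= bin_small ?muln0 //; lia.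
    have -> : (n - i == 0)%N = false by lia.
    by rewrite -bin_sub; [congr (_ * 'C(_, _))%N|]; lia.
  rewrite bin_small // add0r; case: ifP => // _.
  case: gn => [->|n1]; first by rewrite mul0n.
  by rewrite bin_small ?muln0 //; lia.
rewrite big_ord_recl /= scale1r mul1r subn0; congr (_ + _).
case: gn => [g0|n1].
  rewrite g0 !mul0r big1 // => i _; case: ifP => _; by rewrite scale0r.
have [k kE] : exists k, n./2 = k.+1 by exists n./2.-1; lia.
rewrite kE big_ord_recl /= big1 ?addr0 => [|i _]; last by rewrite scale0r.
by rewrite expr1 -mul_polyC -natz -mulrA polyC_natr.
Qed.

Lemma points_complex (g : nat) : exists (T : finType) (Gamma : {set {set T}}),
  [/\ simplicial_complex Gamma, flag Gamma &
    forall i : nat,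
      fnum Gamma i = (if i == 0 then 1 else if i == 1 then g else 0)%N].
Proof.
exists 'I_g, [set s : {set 'I_g} | (#|s| <= 1)%N]; split.
- split=> [|s t st]; first by rewrite inE cards0.
  by rewrite !inE; apply: leq_trans (subset_leq_card st).
- move=> s /minsetP[]; rewrite inE -ltnNge => s1 mins; rewrite leqNgt.
  (* Removing a point from three or more leaves at least two, still a nonface. *)
  apply/negP => s2; have [x xs] : exists x, x \in s by apply/card_gt0P/ltnW.
  have sx : #|s :\ x| = #|s|.-1 by rewrite (cardsD1 x s) xs.
  have /(congr1 (fun t : {set _} => x \in t)) : s :\ x = s.
    by apply: mins (subD1set s x); rewrite inE sx; move: s2; lia.
  by rewrite xs !inE eqxx.
- move=> i; rewrite /fnum.
  have -> : [set s in [set s : {set 'I_g} | (#|s| <= 1)%N] | #|s| == i] =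
      if (i <= 1)%N then [set s : {set 'I_g} | #|s| == i] else set0.
    apply/setP => s; rewrite !inE; case: ifP => i1; rewrite !inE.
      by case: eqP => [->|]; rewrite ?i1 ?andbF.
    by case: eqP => [->|]; rewrite ?i1 ?andbF.
  by case: i => [|[|i]] /=; rewrite ?cards0 // card_draws card_ord ?bin0 ?bin1.
Qed.

End TwoTermGamma.

Theorem corollary1p4 (m : nat) (hm : 1 <= m) (c : 'I_m -> nat)
    (hc : forall i : 'I_m, 0 < c i) (M : {set cmonomial c})
    (hM : proper_multicomplex M) (hflag : flag (Bier M)) :
  exists g : nat -> int,
    gamma_vector (Bier M) g /\
    exists (T : finType) (Gamma : {set {set T}}),
      [/\ simplicial_complex Gamma, flag Gamma
        & forall i : nat, g i = Posz (fnum Gamma i)].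
Proof.
have [[M0 Mdvd] Mp] := hM.
have [g [gn gE]] := Bier_gamma_poly hc Mdvd Mp M0 hflag.
exists (fun i => if i == 0%N then 1 else if i == 1%N then g%:Z else 0)%R; split.
  exact: gamma_vector_two_terms gn gE.
have [T [Gamma [cG fG numG]]] := points_complex g.
exists T, Gamma; split=> // i; rewrite numG.
by case: i => [|[]].
Qed.
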